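(* Let $G$ be a graph and $(H, f)$ be a valued cover of $G$. If $(H, f)$ is a minimal non-strictly $f$-degenerate pair, then $G$ is connected and $f(v, 1) + f(v, 2) + \dots + f(v, s) \leq \deg_{G}(v)$ for each $v \in V(G)$.
   Context: All graphs are simple, finite and undirected; $s$ is a positive integer. A cover of a graph $G$ is a graph $H$ with vertex set $\bigcup_{v \in V(G)} X_v$, where $X_v = \{(v,1), \dots, (v,s)\}$, and edge set $\bigcup_{uv \in E(G)} \mathscr{M}_{uv}$, where each $\mathscr{M}_{uv}$ is a (possibly empty) matching between $X_u$ and $X_v$. A valued cover of $G$ is a pair $(H, f)$ with $H$ a cover of $G$ and $f$ a function from $V(H)$ to the nonnegative integers; write $f(v,q)$ for $f((v,q))$. A set $R \subseteq V(H)$ is a transversal of $H$ if $|R \cap X_v| = 1$ for each $v \in V(G)$. A graph with a nonnegative integer valued function $f$ on its vertices is strictly $f$-degenerate if every nonempty subgraph $\Gamma$ of it has a vertex $x$ with $\deg_\Gamma(x) < f(x)$. A transversal $R$ is a strictly $f$-degenerate transversal if $H[R]$ is strictly $f$-degenerate. The pair $(H, f)$ is minimal non-strictly $f$-degenerate if $H$ has no strictly $f$-degenerate transversal, but for each $v \in V(G)$ the valued cover $(H - X_v, g)$ of $G - v$ has a strictly $g$-degenerate transversal, where $g$ is the restriction of $f$ to $V(H) \setminus X_v$. *)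

(* Defs.v *)
From mathcomp Require Import all_boot.

Set Implicit Arguments.
Unset Strict Implicit.
Unset Printing Implicit Defensive.

(* A finite simple undirected graph is carried by an ambient finite type [T]:
   its vertex set is a subset of [T], so that subgraphs, induced subgraphs and
   vertex deletions of a graph are again graphs over the same type. *)
Record graph (T : finType) := Graph {
  vset : {set T};
  adj : rel T;
  adj_sym : symmetric adj;
  adj_irrefl : irreflexive adj;
  adj_vset : forall x y, adj x y -> x \in vset
}.

Section Graphs.
Variable T : finType.
Implicit Types (G D : graph T) (A B : {set T}) (x y : T).

Definition deg G x : nat := #|[set y | adj G x y]|.

(* Not necessarily induced. *)
Definition subgraph D G : Prop :=
  vset D \subset vset G /\ forall x y, adj D x y -> adj G x y.

Definition induced_adj G A : rel T :=
  [rel x y | [&& x \in A, y \in A & adj G x y]].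

Fact induced_sym G A : symmetric (induced_adj G A).
Proof. by move=> x y; rewrite /induced_adj /= (adj_sym G) andbCA. Qed.

Fact induced_irrefl G A : irreflexive (induced_adj G A).
Proof. by move=> x; rewrite /induced_adj /= (adj_irrefl G) !andbF. Qed.

Fact induced_vset G A x y : induced_adj G A x y -> x \in vset G :&: A.
Proof. by case/and3P=> xA _ /adj_vset xG; rewrite inE xG. Qed.

Definition induced G A : graph T :=
  Graph (induced_sym G A) (induced_irrefl G A) (@induced_vset G A).

Definition delete G A : graph T := induced G (vset G :\: A).

(* The graph without vertices is not connected. *)
Definition connected G : Prop :=
  vset G != set0 /\
  forall x y, x \in vset G -> y \in vset G -> connect (adj G) x y.

Definition edges_between G A B : rel T :=
  [rel x y | adj G x y
     && ((x \in A) && (y \in B) || (x \in B) && (y \in A))].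

(* Edge sets are symmetric relations, so this says that distinct edges are
   disjoint. *)
Definition matching (M : rel T) : Prop :=
  forall x y z, M x y -> M x z -> y = z.

Definition strictly_degenerate G (f : T -> nat) : Prop :=
  forall D, subgraph D G -> vset D != set0 ->
    exists2 x, x \in vset D & deg D x < f x.

End Graphs.

Section Covers.
Variables (T : finType) (s : nat).
Implicit Types (G : graph T) (H : graph (T * 'I_s)%type).

(* The second coordinates 1, ..., s are numbered 0, ..., s - 1. *)
Definition fibre (v : T) : {set T * 'I_s} := [set p | p.1 == v].

(* The matching attached to an edge uv of G consists of all the edges of H
   between the fibres of u and v. *)
Definition graph_cover G H : Prop :=
  [/\ vset H = \bigcup_(v in vset G) fibre v,
      forall p q, adj H p q -> adj G p.1 q.1
    & forall u v, adj G u v ->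
        matching (edges_between H (fibre u) (fibre v))].

Definition cover_transversal G H (R : {set T * 'I_s}) : Prop :=
  R \subset vset H /\ forall v, v \in vset G -> #|R :&: fibre v| = 1.

(* [f] is given on the whole ambient type, but only its values on [vset H]
   matter; hence restricting a valuation to a subgraph leaves [f] as it is. *)
Definition has_strictly_degenerate_transversal G H (f : T * 'I_s -> nat) :=
  exists2 R, cover_transversal G H R & strictly_degenerate (induced H R) f.

Definition minimal_non_strictly_degenerate G H (f : T * 'I_s -> nat) : Prop :=
  ~ has_strictly_degenerate_transversal G H f /\
  forall v, v \in vset G ->
    has_strictly_degenerate_transversal
      (delete G [set v]) (delete H (fibre v)) f.

End Covers.

(* Main.v *)
Require Import Defs.
From mathcomp Require Import all_boot.

(** The degree bound: let R be a strictly degenerate transversal of H - X_v.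
    Adding (v, q) to R destroys strict degeneracy, and the subgraph witnessing
    this must contain (v, q), so (v, q) has at least f(v, q) neighbours in R.
    Since the edges over uv form a matching, every u adjacent to v is counted
    for at most one q.

    Connectedness: if the component C of x misses y, the part over C of a
    transversal for G - y and the part off C of a transversal for G - x
    together form a strictly degenerate transversal of H. *)

(** * Strict degeneracy tested on vertex sets *)

Section StrictDegeneracy.
Set Implicit Arguments.
Unset Strict Implicit.
Variable T : finType.
Implicit Types (G : graph T) (A B D R : {set T}) (x y : T) (f : T -> nat).

Definition nbrs_in G A x : {set T} := [set y in A | adj G x y].

(** Ranging over vertex sets instead of graphs makes the property decidable, so its failure yields
    an explicit witness [D]. *)
Definition strictly_degenerate_on G R f : bool :=
  [forall D : {set T}, (D \subset R) ==> (D != set0) ==>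
     [exists x in D, #|nbrs_in G D x| < f x]].

Lemma strictly_degenerate_onP G R f :
  reflect (forall D, D \subset R -> D != set0 ->
             exists2 x, x \in D & #|nbrs_in G D x| < f x)
          (strictly_degenerate_on G R f).
Proof.
apply: (iffP forallP) => [h D DR D0|h D].
  by have /implyP/(_ DR)/implyP/(_ D0)/exists_inP := h D.
by apply/implyP => DR; apply/implyP => D0; apply/exists_inP; exact: h.
Qed.

Lemma strictly_degenerate_onPn G R f :
  ~~ strictly_degenerate_on G R f ->
  exists D, [/\ D \subset R, D != set0
    & forall x, x \in D -> f x <= #|nbrs_in G D x|].
Proof.
rewrite negb_forall => /existsP[D]; rewrite 2!negb_imply => /and3P[DR D0 /exists_inPn h].
by exists D; split=> // x /h; rewrite -leqNgt.
Qed.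

Lemma strictly_degenerate_on_sub G A B f :
  A \subset B -> strictly_degenerate_on G B f -> strictly_degenerate_on G A f.
Proof.
move=> AB /strictly_degenerate_onP h; apply/strictly_degenerate_onP => D DA.
by apply: h; apply: subset_trans AB.
Qed.

(** Among the subgraphs on a given vertex set the induced one has the largest degrees, so testing
    induced subgraphs suffices. *)
Lemma strictly_degenerate_inducedE G R f : R \subset vset G ->
  strictly_degenerate (induced G R) f <-> strictly_degenerate_on G R f.
Proof.
move=> RG; split=> [h|/strictly_degenerate_onP h D [DR Dadj] D0].
  apply/strictly_degenerate_onP => D DR D0.
  have vD : vset (induced G D) = D.
    by apply/setIidPr; apply: subset_trans RG.
  case: (h (induced G D)); rewrite ?vD //.
    split=> [|x y /and3P[xD yD xy]]; first by rewrite vD subsetI (subset_trans DR).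
    by apply/and3P; rewrite !(subsetP DR).
  move=> x xD lt_f; exists x => //; apply: leq_ltn_trans lt_f.
  apply: subset_leq_card; apply/subsetP => y; rewrite !inE => /andP[yD xy].
  exact/and3P.
have DsR : vset D \subset R by apply: subset_trans DR (subsetIr _ _).
have [x xD lt_f] := h _ DsR D0; exists x => //; apply: leq_ltn_trans lt_f.
apply: subset_leq_card; apply/subsetP => y; rewrite !inE => xy.
by case/and3P: (Dadj _ _ xy) => _ _ ->; rewrite andbT (@adj_vset _ D y x) // (adj_sym D).
Qed.

Lemma strictly_degenerate_on_induced G A R f : R \subset A ->
  strictly_degenerate_on (induced G A) R f = strictly_degenerate_on G R f.
Proof.
move=> RA; apply: eq_forallb => D; case DR: (D \subset R) => //=.
congr (_ ==> _); apply: eq_existsb => x; case xD: (x \in D) => //=.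
congr (_ < _); apply: eq_card => y; rewrite !inE /=.
have DA z : z \in D -> z \in A by move=> zD; rewrite (subsetP RA) ?(subsetP DR).
by case yD: (y \in D); rewrite //= /induced_adj /= !DA.
Qed.

(** No edge leaves [A], so a vertex of [D :&: A] has all its [D]-neighbours in [D :&: A], and
    likewise for [D :\: A]. A low-degree vertex of whichever piece is nonempty is therefore of low
    degree in [D]. *)
Lemma strictly_degenerate_on_split G R A f :
  (forall x y, adj G x y -> (x \in A) = (y \in A)) ->
  strictly_degenerate_on G (R :&: A) f -> strictly_degenerate_on G (R :\: A) f ->
  strictly_degenerate_on G R f.
Proof.
move=> Aclosed /strictly_degenerate_onP hI /strictly_degenerate_onP hD.
apply/strictly_degenerate_onP => D DR /set0Pn[z zD].
have [zA|zA] := boolP (z \in A).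
  have [||x] := hI (D :&: A); first exact: setSI.
    by apply/set0Pn; exists z; rewrite inE zD.
  rewrite inE => /andP[xD xA] lt_f; exists x => //; apply: leq_ltn_trans lt_f.
  apply: subset_leq_card; apply/subsetP => y; rewrite !inE => /andP[-> xy].
  by rewrite -(Aclosed _ _ xy) xA.
have [||x] := hD (D :\: A); first exact: setSD.
  by apply/set0Pn; exists z; rewrite inE zD zA.
rewrite inE => /andP[xA xD] lt_f; exists x => //; apply: leq_ltn_trans lt_f.
apply: subset_leq_card; apply/subsetP => y; rewrite !inE => /andP[-> xy].
by rewrite -(Aclosed _ _ xy) xA.
Qed.

Lemma strictly_degenerate_setU1_nbrs G R x f :
  strictly_degenerate_on G R f -> ~~ strictly_degenerate_on G (x |: R) f ->
  f x <= #|nbrs_in G R x|.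
Proof.
move=> /strictly_degenerate_onP degR /strictly_degenerate_onPn[D [DR D0 leD]].
have xD : x \in D.
  apply: contraT => xD; have [|//|y yD] := degR D.
    apply/subsetP => y yD; have := subsetP DR y yD.
    by rewrite !inE => /orP[/eqP yx|//]; rewrite yx in yD; rewrite yD in xD.
  by rewrite ltnNge leD.
(* There are no loops, so the neighbours of [x] in [D] differ from [x] and lie in [R]. *)
apply: leq_trans (leD _ xD) _; apply: subset_leq_card.
apply/subsetP => y; rewrite !inE => /andP[yD xy]; rewrite xy andbT.
have := subsetP DR y yD; rewrite !inE => /orP[/eqP yx|//].
by rewrite yx (adj_irrefl G) in xy.
Qed.

End StrictDegeneracy.

(** * Covers and their transversals *)

Section Covers.
Set Implicit Arguments.
Unset Strict Implicit.
Variables (T : finType) (s : nat).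
Implicit Types (G : graph T) (H : graph (T * 'I_s)%type) (R : {set T * 'I_s}).

Lemma mem_cover G H p : graph_cover G H -> (p \in vset H) = (p.1 \in vset G).
Proof.
case=> -> _ _; apply/bigcupP/idP => [[v vG]|pG]; first by rewrite inE => /eqP ->.
by exists p.1; rewrite ?inE.
Qed.

(** The bound is [<= 1] so as to apply also to a transversal of a vertex-deleted cover, which misses
    one fibre. *)
Lemma transversal_fst_inj G H R : graph_cover G H ->
  R \subset vset H -> (forall v, v \in vset G -> #|R :&: fibre s v| <= 1) ->
  {in R &, injective (@fst T 'I_s)}.
Proof.
move=> cov RH R1 p q pR qR pq.
have pG : p.1 \in vset G by rewrite -(mem_cover _ cov) (subsetP RH).
by have /card_le1_eqP := R1 _ pG; apply; rewrite !inE ?pR ?qR ?pq eqxx.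
Qed.

(** Double counting of the edges between [R] and the fibre of [v]: each [r] in [R] meets at most one
    of them, and none unless [r.1] is a neighbour of [v]. *)
Lemma cover_nbrs_sum G H R v : graph_cover G H ->
  {in R &, injective (@fst T 'I_s)} ->
  \sum_(q < s) #|nbrs_in H R (v, q)| <= deg G v.
Proof.
move=> [_ covE covM] Rinj.
have count_edges q : #|nbrs_in H R (v, q)| = \sum_(r in R) adj H (v, q) r.
  by rewrite -sum1_card big_mkcond [RHS]big_mkcond; apply: eq_bigr => r _;
     rewrite !inE; case: (r \in R); case: (adj _ _ _).
rewrite (eq_bigr _ (fun q _ => count_edges q)) exchange_big /=.
pose N := [set r in R | adj G v r.1].
have cardN : #|N| <= deg G v.
  rewrite -(@card_in_imset _ _ fst); last first.
    by move=> p q; rewrite !inE => /andP[pR _] /andP[qR _]; exact: Rinj.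
  apply: subset_leq_card; apply/subsetP => u /imsetP[r].
  by rewrite !inE => /andP[_ vr] ->.
apply: leq_trans cardN; rewrite -sum1_card big_mkcond [leqRHS]big_mkcond.
apply: leq_sum => r _; rewrite inE; case: (r \in R) => //=.
have [vr|nvr] := boolP (adj G v r.1); last first.
  by rewrite big1 // => q _; apply/eqP; rewrite eqb0; apply: contraNN nvr => /covE.
have -> : \sum_(q < s) adj H (v, q) r = #|[set q | adj H (v, q) r]|.
  by rewrite -sum1_card [RHS]big_mkcond; apply: eq_bigr => q _;
     rewrite inE; case: (adj _ _ _).
(* Both [(v, q)] and [(v, q')] are partners of [r] in the matching over the edge from [v] to
   [r.1]. *)
apply/card_le1_eqP => q q'; rewrite !inE => qr q'r.
suff [] : (v, q) = (v, q') by [].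
by apply: (covM _ _ vr r); rewrite /edges_between /= !inE !eqxx orbT andbT (adj_sym H).
Qed.

Lemma has_transversal G H f R : graph_cover G H -> R \subset vset H ->
  (forall v, v \in vset G -> #|R :&: fibre s v| = 1) ->
  strictly_degenerate_on H R f -> has_strictly_degenerate_transversal G H f.
Proof. by move=> cov RH R1 degR; exists R => //; exact/strictly_degenerate_inducedE. Qed.

(** Since [R] avoids the deleted fibre, degeneracy can be measured in [H] itself; transversals from
    different deletions can then be combined. *)
Lemma delete_transversal G H f v :
  has_strictly_degenerate_transversal (delete G [set v]) (delete H (fibre s v)) f ->
  exists R, [/\ R \subset vset H :\: fibre s v,
    forall u, u \in vset G -> u != v -> #|R :&: fibre s u| = 1
    & strictly_degenerate_on H R f].
Proof.
case=> R [RH R1] degR.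
have RHv : R \subset vset H :\: fibre s v by apply: subset_trans RH (subsetIr _ _).
exists R; split=> // [u uG uv|]; first by rewrite R1 // !inE uv uG.
by rewrite -(strictly_degenerate_on_induced H _ RHv); exact/strictly_degenerate_inducedE.
Qed.

(** * Consequences of minimality *)

Section Minimal.
Variables (G : graph T) (H : graph (T * 'I_s)%type) (f : T * 'I_s -> nat).
Hypotheses (coverGH : graph_cover G H) (minHf : minimal_non_strictly_degenerate G H f).

Lemma minimal_vset_neq0 : vset G != set0.
Proof.
apply/negP => /eqP G0; case: minHf => + _; apply.
(* Over a graph without vertices the empty set is a strictly degenerate transversal, vacuously. *)
apply: (@has_transversal _ _ _ set0) => //; first exact: sub0set.
  by move=> v; rewrite G0 inE.
by apply/strictly_degenerate_onP => D; rewrite subset0 => /eqP ->; rewrite eqxx.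
Qed.

Lemma minimal_closed_full (C : {set T}) x y :
  (forall u v, adj G u v -> (u \in C) = (v \in C)) ->
  x \in vset G -> y \in vset G -> x \in C -> y \in C.
Proof.
move=> Cclosed xG yG xC; apply: contraT => yC.
case: minHf => noT /[dup] /(_ _ xG) /delete_transversal[R2 [R2H R2t R2d]].
move=> /(_ _ yG) /delete_transversal[R1 [R1H R1t R1d]]; case: noT.
pose A : {set T * 'I_s} := [set p | p.1 \in C].
(* [R1] lacks only the fibre of [y], which lies outside [A], and [R2] lacks only that of [x], which
   lies inside; so [R] meets every fibre once. *)
pose R := (R1 :&: A) :|: (R2 :\: A).
have RIA : R :&: A = R1 :&: A.
  by apply/setP => p; rewrite !inE; case: (p.1 \in C); rewrite /= ?(andbF, andbT, orbF).
have RDA : R :\: A = R2 :\: A.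
  by apply/setP => p; rewrite !inE; case: (p.1 \in C); rewrite /= ?(andbF, andbT, orbF).
apply: (@has_transversal _ _ _ R) => //.
- apply/subsetP => p /setUP[/setIP[/(subsetP R1H)]|/setDP[/(subsetP R2H)]];
  by rewrite inE => /andP[].
- move=> v vG; have [vC|vC] := boolP (v \in C).
    rewrite -(R1t v) //; last by apply: contraNneq yC => <-.
    apply: eq_card => p; rewrite !inE; have [->|] := eqVneq p.1 v; last by rewrite !andbF.
    by rewrite vC /= orbF !andbT.
  rewrite -(R2t v) //; last by apply: contraNneq vC => ->.
  apply: eq_card => p; rewrite !inE; have [->|] := eqVneq p.1 v; last by rewrite !andbF.
  by rewrite (negPf vC) /= !andbF !andbT.
- apply: (@strictly_degenerate_on_split _ _ _ A).
  + by case: coverGH => _ covE _ p q /covE /Cclosed; rewrite !inE.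
  + by rewrite RIA; apply: strictly_degenerate_on_sub R1d; apply: subsetIl.
  + by rewrite RDA; apply: strictly_degenerate_on_sub R2d; apply: subsetDl.
Qed.

Lemma minimal_connected : connected G.
Proof.
split=> [|x y xG yG]; first exact: minimal_vset_neq0.
suff: y \in [set z | connect (adj G) x z] by rewrite inE.
apply: (@minimal_closed_full _ x) => //; last by rewrite inE connect0.
move=> u v uv; rewrite !inE; apply/idP/idP => h; apply: connect_trans h (connect1 _) => //.
by rewrite (adj_sym G).
Qed.

Lemma minimal_sum_le_deg v : v \in vset G -> \sum_(q < s) f (v, q) <= deg G v.
Proof.
move=> vG; case: minHf => noT /(_ _ vG) /delete_transversal[R [RHv Rt Rd]].
have RH : R \subset vset H by apply: subset_trans RHv (subsetDl _ _).
have Rv : R :&: fibre s v = set0.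
  apply/setP => p; rewrite !inE; apply/negP => /andP[/(subsetP RHv)].
  by rewrite !inE => /andP[/negPf ->].
have Rinj : {in R &, injective (@fst T 'I_s)}.
  (* [R] meets the fibre of [v] in no point and every other fibre in exactly one. *)
  apply: (transversal_fst_inj coverGH RH) => u uG.
  by have [->|uv] := eqVneq u v; rewrite ?Rv ?cards0 // Rt.
apply: leq_trans (@cover_nbrs_sum _ _ _ v coverGH Rinj).
apply: leq_sum => q _; apply: strictly_degenerate_setU1_nbrs => //.
(* Adding [(v, q)] fills the one empty fibre, so strict degeneracy of the result would contradict
   [noT]. *)
apply/negP => degRq; case: noT; apply: has_transversal degRq => //.
  by rewrite subUset sub1set (mem_cover _ coverGH) vG.
move=> u uG; rewrite setIUl; have [->|uv] := eqVneq u v.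
  by rewrite Rv setU0 (setIidPl _) ?cards1 // sub1set inE.
rewrite -[RHS](Rt u) //; congr #|pred_of_set _|; apply/setUidPr/subsetP => p.
by rewrite !inE => /andP[/eqP -> /= /eqP vu]; rewrite vu eqxx in uv.
Qed.

End Minimal.
End Covers.

Theorem theorem4p4 (T : finType) (s : nat) (s_gt0 : 0 < s)
    (G : graph T) (H : graph (T * 'I_s)%type) (f : T * 'I_s -> nat)
    (coverGH : graph_cover G H)
    (minHf : minimal_non_strictly_degenerate G H f) :
  connected G /\
  forall v, v \in vset G -> \sum_(q < s) f (v, q) <= deg G v.
Proof.
split; first exact: minimal_connected minHf.
exact: minimal_sum_le_deg minHf.
Qed.
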